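(* Let $K$ denote $\mathbb{C}$ or $\mathbb{R}$. Let $f:K[x,y]\to K[x,y]$ be a morphism that satisfies $\operatorname{Jac}(f(x),f(y))\in K^*$. If one of the following two conditions is satisfied, then $f$ is invertible: (1) The $(0,1)$-degrees of all monomials in $f(x)$ are of the same parity. (2) The $(1,0)$-degrees of all monomials in $f(x)$ are of the same parity.
   Context: A morphism of $K[x,y]$ is a $K$-algebra endomorphism of $K[x,y]$. For $A,B\in K[x,y]$, $\operatorname{Jac}(A,B)=\frac{\partial A}{\partial x}\frac{\partial B}{\partial y}-\frac{\partial A}{\partial y}\frac{\partial B}{\partial x}$. The monomials in a polynomial are those occurring in it with non-zero coefficient. The $(1,0)$-degree of a monomial $x^iy^j$ is $i$ (its $x$-degree) and its $(0,1)$-degree is $j$ (its $y$-degree). A morphism $f$ is invertible if there is a morphism $h$ of $K[x,y]$ with $fh=hf=1$, the identity morphism. $K^*=K\setminus\{0\}$. *)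

(* Defs.v *)
From HB Require Import structures.
From mathcomp Require Import all_boot all_order all_algebra.
From mathcomp Require Import reals.
From mathcomp Require Import complex.
From mathcomp Require Import mpoly.

Set Implicit Arguments.
Unset Strict Implicit.
Unset Printing Implicit Defensive.
Import GRing.Theory.
Local Open Scope ring_scope.

(* K[x, y] is {mpoly K[2]}: the indices 0 and 1 of 'I_2 stand for x and y. *)
Definition ix : 'I_2 := ord0.
Definition iy : 'I_2 := ord_max.

Definition varX (K : fieldType) : {mpoly K[2]} := 'X_ix.
Definition varY (K : fieldType) : {mpoly K[2]} := 'X_iy.

Definition Jac (K : fieldType) (A B : {mpoly K[2]}) : {mpoly K[2]} :=
  A^`M(ix) * B^`M(iy) - A^`M(iy) * B^`M(ix).

Definition deg10 (m : 'X_{1..2}) : nat := m ix.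
Definition deg01 (m : 'X_{1..2}) : nat := m iy.

Definition same_parity (K : fieldType) (deg : 'X_{1..2} -> nat)
    (p : {mpoly K[2]}) : Prop :=
  forall m1 m2 : 'X_{1..2},
    m1 \in msupp p -> m2 \in msupp p -> odd (deg m1) = odd (deg m2).

Definition Kxy_morphism (K : fieldType) := {lrmorphism {mpoly K[2]} -> {mpoly K[2]}}.

Definition invertible_morphism (K : fieldType) (f : Kxy_morphism K) : Prop :=
  exists h : Kxy_morphism K, (f \o h =1 id) /\ (h \o f =1 id).

(* Main.v *)
Require Import Defs.
From mathcomp Require Import all_boot all_order all_algebra.
From mathcomp Require Import reals.
From mathcomp Require Import complex.
From mathcomp Require Import mpoly.
From mathcomp Require Import zify ring.

Set Implicit Arguments.
Unset Strict Implicit.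

Import GRing.Theory.
Local Open Scope ring_scope.

(** Let p = f(x), q = f(y) and let s be the involution y |-> -y. The hypothesis
    says that s p = p or s p = - p. If p is even in y, Jac(p, q - s q) is again a
    non-zero constant; if p is odd, so is Jac(p, q + s q). In both cases we get a
    Jacobian pair (u, v) such that v vanishes on the axis y = 0. For a monomial
    order with leading monomials x^i y^j of u and x^k y^l of v, the coefficient
    (i l - j k) of the leading term of Jac(u, v) must vanish unless the product of
    the two monomials is x y. Choosing the weight just before a side of the Newton
    polygons forces u = a x + h(y) and v = b y. Hence p has one constant partial
    derivative, so that after a triangular change of coordinates (and possibly the
    exchange of x and y) we may assume f(x) = x, and then f(y) = b y + h(x). *)

(** * Exponents in two variables and coefficients of products *)

Lemma mnm2P (m n : 'X_{1..2}) : m ix = n ix -> m iy = n iy -> m = n.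
Proof.
move=> ex ey; apply/mnmP => i.
by have [->|->] : i = ix \/ i = iy
  by case: i => [[|[|k]] // hk]; [left|right]; apply: val_inj.
Qed.

Lemma mnm1_ix : (U_(ix)%MM ix = 1)%N * (U_(ix)%MM iy = 0)%N.
Proof. by rewrite !mnm1E. Qed.

Lemma mnm1_iy : (U_(iy)%MM ix = 0)%N * (U_(iy)%MM iy = 1)%N.
Proof. by rewrite !mnm1E. Qed.

Definition mnm2E := (@mnmDE 2, mnm1_ix, mnm1_iy).

Lemma exists_max_seq (T : eqType) (r : rel T) (s : seq T) (x0 : T) :
  total r -> transitive r -> x0 \in s ->
  exists2 x, x \in s & forall y, y \in s -> r y x.
Proof.
move=> tot tr; elim: s x0 => // a [|b s] IHs x0 _.
  by exists a; rewrite ?mem_head // => y /[!inE] /eqP ->; case/orP: (tot a a).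
have [x xs xmax] := IHs b (mem_head _ _).
have [rax|rxa] := orP (tot a x).
  exists x; first by rewrite inE xs orbT.
  by move=> y; rewrite inE => /predU1P[->//|/xmax].
exists a; first exact: mem_head.
move=> y; rewrite inE => /predU1P[->|/xmax ryx]; last exact: tr rxa.
by case/orP: (tot a a).
Qed.

(** The Euler operator [x_i d/dx_i] is diagonal on monomials, so unlike the derivative it does not
    shift exponents. *)
Lemma mcoeffXM_mderiv (R : comNzRingType) (n : nat) (i : 'I_n)
    (p : {mpoly R[n]}) (m : 'X_{1..n}) :
  ('X_i * p^`M(i))@_m = p@_m *+ m i.
Proof.
have [mi0|mi_gt0] := posnP (m i).
  rewrite mi0 mulr0n mcoeffM big1 // => -[k1 k2] /= /eqP em.
  rewrite mcoeffX; case: eqP => [ek|]; last by rewrite mul0r.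
  by move/mnmP/(_ i): em; rewrite mi0 -ek mnmDE mnm1E eqxx.
have em : m = (m - U_(i) + U_(i))%MM.
  apply/mnmP => j; rewrite mnmDE mnmBE mnm1E; case: eqP => [<-|_].
    by rewrite subnK.
  by rewrite subn0 addn0.
rewrite mulrC {1}em addmC mcoeffMX mcoeff_mderiv -em.
by rewrite mnmBE mnm1E eqxx -subSn // subn1.
Qed.

Lemma mcoeffM_unique (R : comNzRingType) (n : nat) (p q : {mpoly R[n]})
    (M N : 'X_{1..n}) :
  (forall m k, p@_m != 0 -> q@_k != 0 -> (m + k = M + N)%MM ->
     m = M /\ k = N) ->
  (p * q)@_(M + N) = p@_M * q@_N.
Proof.
move=> uniqMN; rewrite mcoeffM.
have hM : (mdeg M < (mdeg (M + N)).+1)%N by rewrite ltnS mdegD leq_addr.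
have hN : (mdeg N < (mdeg (M + N)).+1)%N by rewrite ltnS mdegD leq_addl.
rewrite (bigD1 (BMultinom hM, BMultinom hN)) //= big1 ?addr0 //.
move=> [k1 k2] /= /andP[/eqP em ne].
have [->|p0] := eqVneq p@_k1 0; first by rewrite mul0r.
have [->|q0] := eqVneq q@_k2 0; first by rewrite mulr0.
have [e1 e2] := uniqMN _ _ p0 q0 (esym em).
by case/eqP: ne; congr pair; apply: val_inj.
Qed.

(** * Leading monomials of a Jacobian pair *)

Lemma jac_euler (K : fieldType) (p q : {mpoly K[2]}) :
  'X_ix * 'X_iy * Jac p q =
  ('X_ix * p^`M(ix)) * ('X_iy * q^`M(iy))
    - ('X_iy * p^`M(iy)) * ('X_ix * q^`M(ix)).
Proof. by rewrite /Jac; ring. Qed.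

(** The coefficient of [M + N] in [x y Jac(p, q)] is [p_M q_N] times [M ix * N iy - M iy * N ix]:
    the condition on [r] lets the sum of the two maxima split in one way only. In [c x y] this
    coefficient is zero unless [M + N] is the exponent of [x y]. *)
Lemma jac_vertex (K : fieldType) (char0 : [pchar K] =i pred0)
    (r : rel 'X_{1..2}) (p q : {mpoly K[2]}) (c : K) (M N : 'X_{1..2}) :
  (forall m n m' n', r m m' -> r n n' -> (m + n = m' + n')%MM ->
     m = m' /\ n = n') ->
  Jac p q = c%:MP ->
  M \in msupp p -> (forall m, m \in msupp p -> r m M) ->
  N \in msupp q -> (forall n, n \in msupp q -> r n N) ->
  (M + N = U_(ix) + U_(iy))%MM \/ (M ix * N iy = M iy * N ix)%N.
Proof.
move=> radd Jc pM Mmax qN Nmax.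
have [->|neMN] := eqVneq (M + N)%MM (U_(ix) + U_(iy))%MM; [by left|right].
have := congr1 (mcoeff (M + N)) (jac_euler p q).
rewrite Jc mulrC mul_mpolyC mcoeffZ -mpolyXD mcoeffX eq_sym (negPf neMN) mulr0.
have uniqMN i j m k : ('X_i * p^`M(i))@_m != 0 -> ('X_j * q^`M(j))@_k != 0 ->
    (m + k = M + N)%MM -> m = M /\ k = N.
  rewrite !mcoeffXM_mderiv => pm qk; apply: radd.
    by apply: Mmax; rewrite mcoeff_msupp; apply: contraNneq pm => ->; rewrite mul0rn.
  by apply: Nmax; rewrite mcoeff_msupp; apply: contraNneq qk => ->; rewrite mul0rn.
rewrite mcoeffB !mcoeffM_unique; do ?exact: uniqMN.
rewrite !mcoeffXM_mderiv !mulrnAl !mulrnAr -!mulrnA => /esym/eqP.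
have nz : p@_M * q@_N != 0 by rewrite mulf_neq0 // -mcoeff_msupp.
rewrite subr_eq0 -[_ *+ (_ * _)]mulr_natr -[X in _ == X]mulr_natr.
rewrite (inj_eq (mulfI nz)) => /eqP e.
(* Characteristic 0 turns the equality in [K] into one of natural numbers; the case split keeps the
   subtraction exact. *)
apply/eqP; move: e; have := pcharf0P K; case: (leqP (N iy * M ix) (N ix * M iy)) => h;
  move=> [/(_ char0) cK _] e.
- have := cK (N ix * M iy - N iy * M ix)%N.
  by rewrite natrB // e subrr eqxx => /esym; lia.
- have := cK (N iy * M ix - N ix * M iy)%N.
  by rewrite natrB ?(ltnW h) // e subrr eqxx => /esym; lia.
Qed.

(* The weight is [a i - b j] on [x^i y^j], ties being broken by [c i + d j]; both
   sides are moved so that no truncated subtraction occurs. *)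
Definition lexle (a b c d : nat) (m n : 'X_{1..2}) : bool :=
  (a * m ix + b * n iy < a * n ix + b * m iy)%N ||
  (a * m ix + b * n iy == a * n ix + b * m iy)%N &&
  (c * m ix + d * m iy <= c * n ix + d * n iy)%N.

Lemma lexle_total (a b c d : nat) : total (lexle a b c d).
Proof. by rewrite /lexle => m n; lia. Qed.

Lemma lexle_trans (a b c d : nat) : transitive (lexle a b c d).
Proof. by rewrite /lexle => n m k; lia. Qed.

(** Equal sums force equality in both comparisons, first of the weights, then of the ties. The forms
    [(a, -b)] and [(c, d)] have determinant [a * d + b * c], so they separate monomials. *)
Lemma lexle_add (a b c d : nat) (m n m' n' : 'X_{1..2}) :
  (0 < a * d + b * c)%N ->
  lexle a b c d m m' -> lexle a b c d n n' -> (m + n = m' + n')%MM ->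
  m = m' /\ n = n'.
Proof.
move=> det hm hn e.
have ex := congr1 (fun u : 'X_{1..2} => u ix) e.
have ey := congr1 (fun u : 'X_{1..2} => u iy) e.
move: ex ey; rewrite /= !mnmDE => ex ey.
suff em : m = m'.
  by split=> //; apply: mnm2P; move: ex ey; rewrite em => /addnI ? /addnI ?.
have [e1 e2] : (a * m ix + b * m' iy = a * m' ix + b * m iy)%N /\
    (c * m ix + d * m iy = c * m' ix + d * m' iy)%N.
  move: hm hn; rewrite /lexle.
  have : (a * m ix + a * n ix = a * m' ix + a * n' ix)%N by rewrite -!mulnDr ex.
  have : (b * m iy + b * n iy = b * m' iy + b * n' iy)%N by rewrite -!mulnDr ey.
  have : (c * m ix + c * n ix = c * m' ix + c * n' ix)%N by rewrite -!mulnDr ex.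
  have : (d * m iy + d * n iy = d * m' iy + d * n' iy)%N by rewrite -!mulnDr ey.
  by lia.
by apply: mnm2P; nia.
Qed.

Lemma jac_lead (K : fieldType) (char0 : [pchar K] =i pred0)
    (a b c d : nat) (p q : {mpoly K[2]}) (k : K) (m0 n0 : 'X_{1..2}) :
  (0 < a * d + b * c)%N -> Jac p q = k%:MP ->
  m0 \in msupp p -> n0 \in msupp q ->
  exists M N, [/\ M \in msupp p, forall m, m \in msupp p -> lexle a b c d m M,
    N \in msupp q, forall n, n \in msupp q -> lexle a b c d n N &
    (M ix + N ix = 1)%N /\ (M iy + N iy = 1)%N \/
    (M ix * N iy = M iy * N ix)%N].
Proof.
move=> det Jk pm0 qn0.
have tot := lexle_total a b c d; have tr := @lexle_trans a b c d.
have [M pM Mmax] := exists_max_seq tot tr pm0.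
have [N qN Nmax] := exists_max_seq tot tr qn0.
exists M, N; split=> //.
have radd m n m' n' : lexle a b c d m m' -> lexle a b c d n n' ->
  (m + n = m' + n')%MM -> m = m' /\ n = n' by exact: lexle_add.
case: (jac_vertex char0 radd Jk pM Mmax qN Nmax) => [e|]; [left|by right].
have ex := congr1 (fun u : 'X_{1..2} => u ix) e.
have ey := congr1 (fun u : 'X_{1..2} => u iy) e.
by move: ex ey; rewrite /= !mnm2E.
Qed.

(** * Jacobian pairs whose second member vanishes on the axis y = 0 *)

Lemma jac_linear_part (K : fieldType) (p q : {mpoly K[2]}) (k : K) :
  Jac p q = k%:MP ->
  p@_U_(ix) * q@_U_(iy) - p@_U_(iy) * q@_U_(ix) = k.
Proof.
move=> /(congr1 (mcoeff 0)); rewrite /Jac mcoeffC eqxx mulr1 => <-.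
by rewrite mcoeffB !(rmorphM (mcoeff 0%MM)) /= !mcoeff_mderiv !mnm0E !mulr1n !add0m.
Qed.

Section VanishingOnAxis.

Variables (K : fieldType) (p q : {mpoly K[2]}) (k : K).
Hypotheses (char0 : [pchar K] =i pred0) (k_neq0 : k != 0).
Hypotheses (Jk : Jac p q = k%:MP).
Hypothesis (qy : forall m, m \in msupp q -> (0 < m iy)%N).

Lemma axis_linear_part : (U_(ix)%MM \in msupp p) && (U_(iy)%MM \in msupp q).
Proof.
have := jac_linear_part Jk.
have -> : q@_U_(ix) = 0.
  apply/eqP/negbNE; rewrite -mcoeff_msupp; apply/negP => /qy.
  by rewrite mnm1_ix.
by rewrite mulr0 subr0 !mcoeff_msupp -negb_or -mulf_eq0 => ->.
Qed.

Let pX : U_(ix)%MM \in msupp p.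
Proof. by case/andP: axis_linear_part. Qed.

Let qY : U_(iy)%MM \in msupp q.
Proof. by case/andP: axis_linear_part. Qed.

(** This order prefers a small [y]-exponent, then a large [x]-exponent. The leading monomials are
    thus [x^i] with [i >= 1] and [x^k y]; they are not proportional, so [i = 1] and [k = 0]. *)
Lemma axis_restriction :
  (forall m, m \in msupp p -> m iy = 0%N -> (m ix <= 1)%N) /\
  (forall m, m \in msupp q -> m iy = 1%N -> m ix = 0%N).
Proof.
have [//|M [N [pM Mmax qN Nmax MN]]] :=
  jac_lead (a := 0) (b := 1) (c := 1) (d := 0) char0 _ Jk pX qY.
have := Mmax _ pX; have := Nmax _ qY; have := qy qN.
rewrite /lexle !mnm2E => h1 h2 h3.
split=> m hm my; [have := Mmax _ hm | have := Nmax _ hm]; rewrite /lexle my; nia.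
Qed.

(* [x] and [y] have maximal weight in [p] and [q] when [x] weighs [B] and [y]
   weighs [- b]. *)
Let ok (b B : nat) : bool :=
  all (fun m : 'X_{1..2} => B * m ix <= B + b * m iy)%N (msupp p) &&
  all (fun m : 'X_{1..2} => B * m ix + b <= b * m iy)%N (msupp q).

(** At [b = 0] the bounds in [ok b D] are the claim, so it is enough that the least admissible [b]
    is 0. *)
Lemma axis_xdegree :
  (forall m, m \in msupp p -> (m ix <= 1)%N) /\
  (forall m, m \in msupp q -> m ix = 0%N).
Proof.
have [pax qax] := axis_restriction.
pose D := (maxn (msize p) (msize q)).+1.
have bndD (m : 'X_{1..2}) : (mdeg m < D)%N -> (m ix < D)%N /\ (m iy < D)%N.
  by rewrite mdegE big_ord_recl big_ord1; rewrite /ix /iy (_ : lift _ _ = ord_max);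
    [lia|exact: val_inj].
have pD m : m \in msupp p -> (m ix < D)%N /\ (m iy < D)%N.
  by move=> /msize_mdeg_lt hm; apply: bndD; rewrite /D; lia.
have qD m : m \in msupp q -> (m ix < D)%N /\ (m iy < D)%N.
  by move=> /msize_mdeg_lt hm; apply: bndD; rewrite /D; lia.
have exok : exists b, ok b D.
  (* So steep a weight lets the [y]-exponent dominate; the lowest rows, where it cannot, are settled
     by [pax] and [qax]. *)
  exists (D * D)%N; apply/andP; split; apply/allP => m hm.
    have := pax _ hm; have := pD _ hm; nia.
  have := qax _ hm; have := qD _ hm; have := qy hm; nia.
(* If the least such [b] is positive, the leading monomials for the weight with
   [b - 1] contradict [jac_lead], because [D] exceeds all exponents. *)
case: (ex_minnP exok) => -[|b] /andP[/allP pok /allP qok] bmin.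
  split=> m hm; [have := pok _ hm | have := qok _ hm]; rewrite /D; nia.
have [//|M [N [pM Mmax qN Nmax MN]]] :=
  jac_lead (a := D) (b := b) (c := 0) (d := 1) char0 _ Jk pX qY.
have := Mmax _ pX; have := Nmax _ qY.
have := pok _ pM; have := qok _ qN; have := pD _ pM; have := qy qN.
rewrite /lexle !mnm2E => h1 h2 h3 h4 h5 h6.
have [Mx [My [Nx Ny]]] :
    (M ix = 1 /\ M iy = 0 /\ N ix = 0 /\ N iy = 1)%N.
  case: MN => MN.
    have N1 : (N iy = 1)%N by lia.
    by move: h3 h4 h5 h6; rewrite N1 (_ : M iy = 0%N); [nia|lia].
  exfalso.
  (* [e1] is the maximality of [M] against [x], times [N iy]; [e2] is the bound [ok] on [N], times
     [M iy]. With [e3] they give [D * N iy <= M iy * N iy], against [e4]. *)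
  have e1 : (D * N iy + b * M iy * N iy <= D * M ix * N iy)%N by nia.
  have e2 : (D * N ix * M iy + b.+1 * M iy <= b.+1 * N iy * M iy)%N by nia.
  have e3 : (D * M ix * N iy = D * N ix * M iy)%N by rewrite -!mulnA MN (mulnC (N ix)).
  have e4 : (M iy * N iy < D * N iy)%N by nia.
  by nia.
(* Leading monomials [x] and [y] for the lowered weight mean that [ok] already holds at [b], against
   minimality. *)
suff /bmin : ok b D by rewrite ltnn.
apply/andP; split; apply/allP => m hm; [have := Mmax _ hm|have := Nmax _ hm];
  rewrite /lexle ?Mx ?My ?Nx ?Ny; lia.
Qed.

(** For the order by [x]-degree, then [y]-degree, the leading monomials are [x y^j] and [y^l] with
    [l > 0]. They are not proportional, so [j = 0] and [l = 1]. *)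
Lemma axis_mderiv :
  p^`M(ix) = (p@_U_(ix))%:MP /\ q^`M(iy) = (q@_U_(iy))%:MP.
Proof.
have [px qx] := axis_xdegree.
have [//|M [N [pM Mmax qN Nmax MN]]] :=
  jac_lead (a := 1) (b := 0) (c := 0) (d := 1) char0 _ Jk pX qY.
have := Mmax _ pX; have := px _ pM; have := qx _ qN; have := qy qN.
rewrite /lexle !mnm2E => h1 h2 h3 h4.
split; apply/mpolyP => m; rewrite mcoeff_mderiv mcoeffC;
  (have [->|m0] := eqVneq m 0%MM; first by rewrite mnm0E mulr1n mulr1 add0m);
  rewrite mulr0; apply/eqP; move: m0; apply: contraNT => nz.
  have hm : (m + U_(ix))%MM \in msupp p.
    by rewrite mcoeff_msupp; apply: contraNneq nz => ->; rewrite mul0rn.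
  have := Mmax _ hm; have := px _ hm; rewrite /lexle !mnm2E => h5 h6.
  by apply/eqP/mnm2P; rewrite mnm0E; nia.
have hm : (m + U_(iy))%MM \in msupp q.
  by rewrite mcoeff_msupp; apply: contraNneq nz => ->; rewrite mul0rn.
have := Nmax _ hm; have := qx _ hm; rewrite /lexle !mnm2E => h5 h6.
by apply/eqP/mnm2P; rewrite mnm0E; nia.
Qed.

End VanishingOnAxis.

(** * Morphisms, the chain rule and the exchange of variables *)

Section Morphisms.

Variable K : fieldType.
Implicit Types (f g : Kxy_morphism K) (p q : {mpoly K[2]}).

Lemma mpolyX2 (m : 'X_{1..2}) :
  'X_[K, m] = varX K ^+ m ix * varY K ^+ m iy.
Proof.
rewrite mpolyXE_id big_ord_recl big_ord1 (_ : lift _ _ = iy) //.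
exact: val_inj.
Qed.

Lemma morphE f p :
  f p = \sum_(m <- msupp p)
    p@_m *: (f (varX K) ^+ m ix * f (varY K) ^+ m iy).
Proof.
rewrite {1}[p]mpolyE raddf_sum /=; apply: eq_bigr => m _.
by rewrite linearZ /= mpolyX2 rmorphM /= !rmorphXn.
Qed.

Lemma morph_ext f g :
  f (varX K) = g (varX K) -> f (varY K) = g (varY K) -> f =1 g.
Proof. by move=> eX eY p; rewrite (morphE f) (morphE g) eX eY. Qed.

Lemma morphC f (c : K) : f c%:MP = c%:MP.
Proof. by rewrite -[c%:MP]mulr1 mul_mpolyC linearZ /= rmorph1. Qed.

Lemma mderiv_varX : ((varX K)^`M(ix) = 1) * ((varX K)^`M(iy) = 0).
Proof.
by rewrite /varX !mderivX !mnm1E scale0r scale1r /= -[X in 'X_[X - _]]addm0 addmC addmK mpolyX0.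
Qed.

Lemma mderiv_varY : ((varY K)^`M(ix) = 0) * ((varY K)^`M(iy) = 1).
Proof.
by rewrite /varY !mderivX !mnm1E scale0r scale1r /= -[X in 'X_[X - _]]addm0 addmC addmK mpolyX0.
Qed.

Lemma mderiv_morph f (i : 'I_2) p :
  (f p)^`M(i) = f p^`M(ix) * (f (varX K))^`M(i) +
                f p^`M(iy) * (f (varY K))^`M(i).
Proof.
pose P p := (f p)^`M(i) = f p^`M(ix) * (f (varX K))^`M(i) +
                f p^`M(iy) * (f (varY K))^`M(i).
have P1 : P 1 by rewrite /P rmorph1 -mpolyC1 !mderivC !rmorph0 !mul0r addr0.
(* By the Leibniz rule the identity passes to products, so it need only be checked on the two
   variables. *)
have PM u v : P u -> P v -> P (u * v).
  rewrite /P rmorphM /= !mderivM => -> ->.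
  by rewrite !rmorphD /= !rmorphM /=; ring.
have PX n u : P u -> P (u ^+ n).
  by move=> Pu; elim: n => [|n IHn] //; rewrite exprS; apply: PM.
rewrite -/(P p); elim/mpolyind: p => [|c m p _ _ Pp].
  by rewrite /P !(raddf0, mderiv0) !mul0r addr0.
have Pm : P 'X_[m].
  rewrite mpolyX2; apply: PM; apply: PX; rewrite /P.
    by rewrite !mderiv_varX rmorph1 rmorph0; ring.
  by rewrite !mderiv_varY rmorph1 rmorph0; ring.
move: Pp Pm; rewrite /P => Pp Pm.
rewrite rmorphD /= linearZ /= !mderivD !mderivZ Pp Pm.
by rewrite !rmorphD /= !linearZ /= -!mul_mpolyC; ring.
Qed.

Lemma jac_morph f p q :
  Jac (f p) (f q) = f (Jac p q) * Jac (f (varX K)) (f (varY K)).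
Proof.
rewrite /Jac !(mderiv_morph f _ p) !(mderiv_morph f _ q).
by rewrite rmorphB /= !rmorphM /=; ring.
Qed.

Definition ev p q : Kxy_morphism K := comp_mpoly [tuple p; q].

Lemma ev_varX p q : ev p q (varX K) = p.
Proof. by rewrite /ev /varX /= comp_mpolyXU. Qed.

Lemma ev_varY p q : ev p q (varY K) = q.
Proof. by rewrite /ev /varY /= comp_mpolyXU. Qed.

Definition evE := (ev_varX, ev_varY).

Lemma morph_id f : f (varX K) = varX K -> f (varY K) = varY K -> f =1 id.
Proof. by move=> eX eY; apply: (morph_ext (g := idfun)). Qed.

(** This and the next lemma allow [f] to be composed with automorphisms on either side. *)
Lemma invertible_cancel_left f g :
  invertible_morphism g -> invertible_morphism (g \o f : Kxy_morphism K) ->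
  invertible_morphism f.
Proof.
move=> [g' [gg' g'g]] [h [gfh hgf]].
exists (h \o g : Kxy_morphism K); split=> p /=; last exact: hgf.
have /= e := gfh (g p).
by rewrite -[LHS]g'g /= e; apply: g'g.
Qed.

Lemma invertible_cancel_right f g :
  invertible_morphism g -> invertible_morphism (f \o g : Kxy_morphism K) ->
  invertible_morphism f.
Proof.
move=> [g' [gg' g'g]] [h [fgh hfg]].
exists (g \o h : Kxy_morphism K); split=> p /=; first exact: fgh.
have /= e := hfg (g' p).
have /= gg'p := gg' p.
by rewrite -[p in f p]gg'p e.
Qed.

Definition swap : Kxy_morphism K := ev (varY K) (varX K).

Lemma swapE : (swap (varX K) = varY K) * (swap (varY K) = varX K).
Proof. by rewrite /swap !evE. Qed.

Lemma swapK p : swap (swap p) = p.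
Proof.
have h : (swap \o swap : Kxy_morphism K) =1 id by apply: morph_id; rewrite /= !swapE.
exact: h.
Qed.

Lemma swap_invertible : invertible_morphism swap.
Proof. by exists swap; split=> p; apply: swapK. Qed.

Lemma mderiv_swap p :
  ((swap p)^`M(ix) = swap p^`M(iy)) * ((swap p)^`M(iy) = swap p^`M(ix)).
Proof.
by split; rewrite (mderiv_morph swap _ p) !swapE !mderiv_varX !mderiv_varY; ring.
Qed.

Lemma jac_swap p q : Jac (swap p) (swap q) = - swap (Jac p q).
Proof.
rewrite jac_morph !swapE /Jac !mderiv_varX !mderiv_varY; ring.
Qed.

(** * Triangular morphisms *)

Hypothesis char0 : [pchar K] =i pred0.

(** In characteristic 0 a zero [x]-derivative leaves only powers of [y]. *)
Lemma morph_fix f p :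
  p^`M(ix) = 0 -> f (varY K) = varY K -> f p = p.
Proof.
move=> px fY; rewrite morphE [RHS]mpolyE !big_seq; apply: eq_bigr => m hm.
rewrite mpolyX2 fY; suff -> : m ix = 0%N by rewrite !expr0.
have /eqP := congr1 (mcoeff m) (congr1 (fun u => 'X_ix * u) px).
rewrite mcoeffXM_mderiv mulr0 mcoeff0 -mulr_natr mulf_eq0.
rewrite (negPf (_ : p@_m != 0)) -?mcoeff_msupp //=.
by rewrite ((pcharf0P K).1 char0) => /eqP.
Qed.

Lemma shear_inverse f (a : K) :
  a != 0 -> (f (varX K))^`M(ix) = a%:MP -> f (varY K) = varY K ->
  exists g, [/\ f \o g =1 id, g \o f =1 id, g (varY K) = varY K &
    (g (varX K))^`M(ix) = (a^-1)%:MP].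
Proof.
move=> a0 fXx fY; pose h := f (varX K) - a *: varX K.
have hx : h^`M(ix) = 0.
  by rewrite /h mderivB fXx mderivZ mderiv_varX -mul_mpolyC mulr1 subrr.
(* [f] sends [x] to [a x + h(y)]; solving for [x] gives [g], and both morphisms fix [h]. *)
pose g := ev (a^-1 *: (varX K - h)) (varY K).
have gY : g (varY K) = varY K by rewrite evE.
have gX : g (varX K) = a^-1 *: (varX K - h) by rewrite evE.
have fX : f (varX K) = a *: varX K + h by rewrite /h addrC subrK.
exists g; split=> //.
- apply: (@morph_id (f \o g : Kxy_morphism K)); rewrite /= ?gY //.
  rewrite gX linearZ /= rmorphB /= (morph_fix hx fY) fX addrK.
  by rewrite scalerA mulVf // scale1r.
- apply: (@morph_id (g \o f : Kxy_morphism K)); rewrite /= ?fY //.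
  rewrite fX rmorphD /= linearZ /= (morph_fix hx gY) gX.
  by rewrite scalerA mulfV // scale1r subrK.
by rewrite gX mderivZ mderivB hx subr0 mderiv_varX -mul_mpolyC mulr1.
Qed.

Lemma shear_invertible f (a : K) :
  a != 0 -> (f (varX K))^`M(ix) = a%:MP -> f (varY K) = varY K ->
  invertible_morphism f.
Proof. by move=> a0 fX fY; have [g []] := shear_inverse a0 fX fY; exists g. Qed.

(** The shear [t] takes [x] to [f(x)]. After its inverse [g], the composite [g \o f] fixes [x], and
    the Jacobian makes it a shear in [y]. *)
Lemma jac_const_shear f (a c : K) :
  a != 0 -> (f (varX K))^`M(ix) = a%:MP ->
  c != 0 -> Jac (f (varX K)) (f (varY K)) = c%:MP ->
  invertible_morphism f.
Proof.
move=> a0 fXx c0 Jc; pose t := ev (f (varX K)) (varY K).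
have tY : t (varY K) = varY K by rewrite evE.
have tXx : (t (varX K))^`M(ix) = a%:MP by rewrite evE.
have [g [tg gt gY gXx]] := shear_inverse a0 tXx tY.
have gfX : g (f (varX K)) = varX K by have := gt (varX K); rewrite /= evE.
have gfYy : (g (f (varY K)))^`M(iy) = (c / a)%:MP.
  have := jac_morph g (f (varX K)) (f (varY K)).
  rewrite Jc morphC gfX /Jac gY !mderiv_varX !mderiv_varY gXx.
  by rewrite mul0r !subr0 mul1r mulr0 subr0 mulr1 -mpolyCM.
apply: (@invertible_cancel_left f g); first by exists t.
(* Conjugation by [swap] turns the shear in [y] into one in [x]. *)
apply: (invertible_cancel_left swap_invertible).
apply: (invertible_cancel_right swap_invertible).
apply: (@shear_invertible _ (c / a)); first by rewrite mulf_neq0 ?invr_neq0.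
  by rewrite /= swapE mderiv_swap gfYy morphC.
by rewrite /= swapE gfX swapE.
Qed.

(** * The involution y -> -y and parity in y *)

Definition conjY : Kxy_morphism K := ev (varX K) (- varY K).

Lemma mcoeff_conjY p (m : 'X_{1..2}) : (conjY p)@_m = (-1) ^+ m iy * p@_m.
Proof.
rewrite morphE raddf_sum /= [in RHS](mpolyE p) raddf_sum /= mulr_sumr.
apply: eq_bigr => n _; rewrite !evE (exprNn (varY K)) mulrCA -mpolyX2.
rewrite -(rmorph_sign (@mpolyC 2 K)) mul_mpolyC !mcoeffZ mcoeffX.
by have [->|] := eqVneq n m; rewrite ?mulr0 // !mulr1 mulrC.
Qed.

Lemma jac_conjY p q : Jac (conjY p) (conjY q) = - conjY (Jac p q).
Proof.
by rewrite jac_morph !evE /Jac mderivN mderivN !mderiv_varX !mderiv_varY; ring.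
Qed.

Lemma conjY_sign p (e : bool) :
  (forall m, m \in msupp p -> odd (m iy) = e) -> conjY p = (-1) ^+ e *: p.
Proof.
move=> he; apply/mpolyP => m; rewrite mcoeff_conjY mcoeffZ.
have [hm|] := boolP (m \in msupp p); first by rewrite -signr_odd he.
by rewrite mcoeff_msupp negbK => /eqP ->; rewrite !mulr0.
Qed.

Lemma invertible_of_y_parity f (c : K) (e : bool) :
  c != 0 -> Jac (f (varX K)) (f (varY K)) = c%:MP ->
  (forall m, m \in msupp (f (varX K)) -> odd (m iy) = e) ->
  invertible_morphism f.
Proof.
set p := f (varX K); set q := f (varY K) => c0 Jc he.
(* [conjY] multiplies [p] by the sign of its parity and reverses the sign of Jacobians. *)
have Jconj : Jac p (conjY q) = - ((-1) ^+ e * c)%:MP.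
  have := jac_conjY p q; rewrite Jc morphC (conjY_sign he) /Jac !mderivZ.
  rewrite -!scalerAl -scalerBr => /(congr1 ( *:%R ((-1) ^+ e))).
  by rewrite scalerA -expr2 sqrr_sign scale1r => ->; rewrite scalerN -mul_mpolyC -mpolyCM.
have c2 : c + c != 0.
  by rewrite -mulr2n -mulr_natr mulf_neq0 // ((pcharf0P K).1 char0).
case: e he Jconj => he; rewrite ?expr1 ?expr0 ?mulN1r ?mul1r ?mpolyCN ?opprK => Jconj.
(* For [p] odd in [y], it is [p] that vanishes on the axis, so it takes the second place in the
   pair; its constant [y]-derivative is then moved to [x] by [swap]. *)
- have Jq : Jac (q + conjY q) p = (- (c + c))%:MP.
    transitivity (- (Jac p q + Jac p (conjY q))); first by rewrite /Jac !mderivD; ring.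
    by rewrite Jc Jconj -mpolyCD mpolyCN.
  have py m : m \in msupp p -> (0 < m iy)%N by move=> /he /odd_gt0.
  have cN : - (c + c) != 0 by rewrite oppr_eq0.
  have [_ pyE] := axis_mderiv char0 cN Jq py.
  have /andP[_] := axis_linear_part cN Jq py; rewrite mcoeff_msupp => a0.
  apply: (invertible_cancel_left swap_invertible).
  apply: (@jac_const_shear _ (p@_U_(iy)) (- c)) => //.
  + by rewrite /= mderiv_swap pyE morphC.
  + by rewrite oppr_eq0.
  by rewrite /= jac_swap Jc morphC mpolyCN.
(* For [p] even in [y], the second member is twice the odd part of [q], which vanishes on the
   axis. *)
have Jq : Jac p (q - conjY q) = (c + c)%:MP.
  transitivity (Jac p q - Jac p (conjY q)); first by rewrite /Jac !mderivB; ring.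
  by rewrite Jc Jconj opprK -mpolyCD.
have qy m : m \in msupp (q - conjY q) -> (0 < m iy)%N.
  rewrite mcoeff_msupp mcoeffB mcoeff_conjY lt0n; apply: contraNneq => ->.
  by rewrite expr0 mul1r subrr.
have [pxE _] := axis_mderiv char0 c2 Jq qy.
have /andP[+ _] := axis_linear_part c2 Jq qy; rewrite mcoeff_msupp => a0.
exact: (jac_const_shear a0 pxE c0 Jc).
Qed.

End Morphisms.

(** * The two parity conditions *)

Lemma same_parityP (K : fieldType) (deg : 'X_{1..2} -> nat) (p : {mpoly K[2]}) :
  same_parity deg p ->
  exists e : bool, forall m, m \in msupp p -> odd (deg m) = e.
Proof.
(* For [p = 0] either parity will do. *)
move=> hp; case E: (msupp p) => [|m0 s]; first by exists true.
exists (odd (deg m0)) => m hm; by apply: hp; rewrite E // mem_head.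
Qed.

Lemma mcoeff_swap (K : fieldType) (p : {mpoly K[2]}) (m : 'X_{1..2}) :
  (swap K p)@_m = p@_[multinom m (rev_ord i) | i < 2].
Proof.
rewrite morphE raddf_sum /= [in RHS](mpolyE p) raddf_sum /=.
apply: eq_bigr => n _; rewrite !swapE !mcoeffZ mcoeffX; congr (_ * _).
have -> : varY K ^+ n ix * varX K ^+ n iy = 'X_[[multinom n (rev_ord i) | i < 2]].
  rewrite mpolyX2 !mnmE mulrC; congr (_ ^+ n _ * _ ^+ n _); exact: val_inj.
rewrite mcoeffX; congr ((nat_of_bool _)%:R).
by apply/eqP/eqP => [<-|->]; apply/mnmP => i; rewrite !mnmE rev_ordK.
Qed.

Theorem theorem3p4 (R : realType) (K : fieldType)
    (hK : K = (R : fieldType) \/ K = (R[i]%C : fieldType))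
    (f : Kxy_morphism K)
    (hJac : exists c : K, c != 0 /\ Jac (f (varX K)) (f (varY K)) = c%:MP)
    (hpar : same_parity deg01 (f (varX K)) \/ same_parity deg10 (f (varX K))) :
  invertible_morphism f.
Proof.
have char0 : [pchar K] =i pred0.
  by case: hK => ->; apply: Num.Theory.pchar_num.
have [c [c0 Jc]] := hJac.
case: hpar => /same_parityP[e he]; first exact: (invertible_of_y_parity char0 c0 Jc he).
(* Composition with [swap] exchanges the two degrees and replaces [c] by [- c], which reduces the
   second condition to the first. *)
apply: (invertible_cancel_left (swap_invertible K)).
apply: (@invertible_of_y_parity _ char0 _ (- c) e); rewrite /= ?oppr_eq0 //.
  by rewrite jac_swap Jc morphC mpolyCN.
move=> m; rewrite mcoeff_msupp mcoeff_swap -mcoeff_msupp => /he.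
by rewrite /deg10 mnmE (_ : rev_ord ix = iy) //; apply: val_inj.
Qed.
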